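(* Let $(W,S)$ be a Coxeter system with $S$ finite. Let $\mathcal{S}$ be the set of all spherical subsets of $S$, and for $T\in\mathcal{S}$ let $\chi_T=\sum_{T\subseteq U\in\mathcal{S}}(-1)^{|U|}$ (the sum is over all $U\in\mathcal{S}$ containing $T$). Then $$\sum_{T\in\mathcal{S}}\frac{(-1)^{|T|}\chi_T}{W_T(t)}=\frac{1}{W(t)}$$ as an identity of formal power series in $t$.
   Context: A Coxeter system $(W,S)$: $W$ is the group generated by the finite set $S$ subject to the relations $(st)^{m_{st}}=1$ for $s,t\in S$, where $m_{ss}=1$ and, for $s\neq t$, $m_{st}=m_{ts}\in\{2,3,\ldots,\infty\}$ ($m_{st}=\infty$ means no relation). For $w\in W$, $\ell(w)$ denotes the word length of $w$ with respect to $S$. For $T\subseteq S$, $W_T$ is the subgroup of $W$ generated by $T$ (so $W_\emptyset=\{1\}$ and $W_S=W$); it is a Coxeter group with generating set $T$, and its word length with respect to $T$ is the restriction of $\ell$. A subset $T\subseteq S$ is called spherical if $W_T$ is finite (the empty set is spherical). The growth series of $W_T$ is the formal power series $W_T(t)=\sum_{w\in W_T}t^{\ell(w)}$ (in particular $W(t)=\sum_{w\in W}t^{\ell(w)}$); it has constant term $1$, hence is invertible in $\mathbb{Z}[[t]]$. *)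

(* Defs.v *)
From HB Require Import structures.
From mathcomp Require Import all_boot all_order all_algebra finmap.
From mathcomp Require Import mathcomp_extra boolp classical_sets functions cardinality.

Set Implicit Arguments.
Unset Strict Implicit.
Unset Printing Implicit Defensive.

Import GRing.Theory.

Local Open Scope ring_scope.

(* Formal power series: [a n] is the coefficient of t^n in [a : fps R].
   Addition is pointwise and multiplication is the Cauchy product. *)

Definition fps (R : comUnitRingType) : Type := nat -> R.

HB.instance Definition _ (R : comUnitRingType) :=
  GRing.Zmodule.copy (fps R) (nat -> R).

Section FpsRing.
Variable R : comUnitRingType.
Implicit Types a b c : fps R.

Definition fps_one : fps R := fun n => (n == 0%N)%:R.

Definition fps_mul a b : fps R :=
  fun n => \sum_(i < n.+1) a i * b (n - i)%N.

Let trunc n a : {poly R} := \poly_(i < n) a i.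

Let trunc_mul n k a b : (k < n)%N -> (trunc n a * trunc n b)`_k = fps_mul a b k.
Proof.
move=> kn; rewrite coefM; apply: eq_bigr => i _.
by rewrite !coef_poly (leq_trans (ltn_ord i) kn) (leq_ltn_trans (leq_subr i k) kn).
Qed.

Let fps_mulA : associative fps_mul.
Proof.
move=> a b c; apply/funext => n.
transitivity ((trunc n.+1 a * (trunc n.+1 b * trunc n.+1 c))`_n).
  rewrite coefM; apply: eq_bigr => i _.
  by rewrite coef_poly ltn_ord trunc_mul // ltnS leq_subr.
rewrite mulrA coefM; apply: eq_bigr => i _.
by rewrite trunc_mul // coef_poly ltnS leq_subr.
Qed.

Let fps_mulC : commutative fps_mul.
Proof.
by move=> a b; apply/funext => n; rewrite -!(trunc_mul _ _ (ltnSn n)) mulrC.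
Qed.

Let fps_mul1 : left_id fps_one fps_mul.
Proof.
move=> a; apply/funext => n; rewrite /fps_mul big_ord_recl /= subn0 mul1r.
by rewrite big1 ?addr0 // => i _; rewrite /fps_one /= mul0r.
Qed.

Let fps_mulDl : left_distributive fps_mul +%R.
Proof.
move=> a b c; apply/funext => n.
change (\sum_(i < n.+1) (a i + b i) * c (n - i)%N = fps_mul a c n + fps_mul b c n).
by rewrite -big_split; apply: eq_bigr => i _; rewrite mulrDl.
Qed.

Let fps_one_neq0 : fps_one != 0.
Proof.
apply/eqP => /(congr1 (fun a : fps R => a 0%N)) /eqP.
by rewrite /fps_one eqxx (oner_eq0 R).
Qed.

HB.instance Definition _ := GRing.Zmodule_isComNzRing.Build (fps R)
  fps_mulA fps_mulC fps_mul1 fps_mulDl fps_one_neq0.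

(* The first n.+1 coefficients of the inverse of [a], most recent first,
   computed from  b_0 = a_0^-1,  b_n = - a_0^-1 * \sum_(1 <= i <= n) a_i b_(n-i). *)
Fixpoint fps_inv_seq a n : seq R :=
  if n is m.+1 then
    let s := fps_inv_seq a m in
    - (a 0%N)^-1 * (\sum_(i < m.+1) a i.+1 * s`_i) :: s
  else [:: (a 0%N)^-1].

Definition fps_unit : pred (fps R) := fun a => a 0%N \is a GRing.unit.

Definition fps_inv a : fps R :=
  if fps_unit a then fun n => (fps_inv_seq a n)`_0 else a.

Let fps_inv_seqE a n i : (i <= n)%N ->
  (fps_inv_seq a n)`_i = (fps_inv_seq a (n - i))`_0.
Proof.
elim: n i => [|n IH] [|i] //= ni.
by rewrite IH.
Qed.

Let fps_mulVr : {in fps_unit, left_inverse 1 fps_inv *%R}.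
Proof.
move=> a ua; rewrite mulrC; apply/funext => n.
have {}ua : fps_unit a by [].
rewrite /fps_inv ua; change (fps_mul a (fun n => (fps_inv_seq a n)`_0) n = fps_one n).
rewrite /fps_mul big_ord_recl subn0 /fps_one.
case: n => [|n]; first by rewrite big_ord0 addr0 /= divrr.
rewrite /= mulrA mulrN divrr // mulN1r addrC; apply/eqP; rewrite subr_eq0; apply/eqP.
apply: eq_bigr => i _ /=; rewrite /bump /= add1n subSS.
by rewrite (fps_inv_seqE a (leq_ord i)).
Qed.

Let fps_unitPl a b : b * a = 1 -> fps_unit a.
Proof.
move=> /(congr1 (fun c : fps R => c 0%N)).
change (fps_mul b a 0%N = fps_one 0%N -> fps_unit a).
rewrite /fps_mul big_ord1 /fps_one eqxx => ba1.
by apply/unitrPr; exists (b 0%N); rewrite mulrC.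
Qed.

Let fps_inv_out : {in [predC fps_unit], fps_inv =1 id}.
Proof. by move=> a nua; rewrite /fps_inv; case: ifP => // ua; case/negP: nua. Qed.

HB.instance Definition _ := GRing.ComNzRing_hasMulInverse.Build (fps R)
  fps_mulVr fps_unitPl fps_inv_out.

Lemma fps_mulE a b n : (a * b) n = \sum_(i < n.+1) a i * b (n - i)%N.
Proof. by []. Qed.

Lemma fps_oneE n : (1 : fps R) n = (n == 0%N)%:R.
Proof. by []. Qed.

Lemma fps_unitE a : (a \is a GRing.unit) = (a 0%N \is a GRing.unit).
Proof. by []. Qed.

End FpsRing.

(* A Coxeter matrix; [None] stands for infinity. *)
Record is_coxeter_matrix (S : finType) (m : S -> S -> option nat) : Prop := {
  coxeter_matrix_diag : forall s, m s s = Some 1%N;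
  coxeter_matrix_sym : forall s t, m s t = m t s;
  coxeter_matrix_off : forall s t k, s != t -> m s t = Some k -> (2 <= k)%N }.

Section Coxeter.
Local Open Scope group_scope.

Definition coxeter_relations (S : finType) (m : S -> S -> option nat)
    (G : groupType) (f : S -> G) : Prop :=
  forall s t k, m s t = Some k -> (f s * f t) ^+ k = 1.

Variables (S : finType) (W : groupType) (gen : S -> W).

Definition is_subgroup (H : set W) : Prop :=
  H 1 /\ forall x y, H x -> H y -> H (x * y^-1).

(* W_T *)
Definition parabolic (T : {set S}) : set W :=
  smallest is_subgroup [set gen s | s in [set` T]].

(* W is presented by the generators [gen s] and the Coxeter relations of m:
   the generators satisfy the relations, they generate W, and every map from S
   to a group satisfying the relations extends to a homomorphism from W (such
   an extension is unique because S generates W). *)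
Record is_coxeter_system (m : S -> S -> option nat) : Prop := {
  coxeter_system_matrix : is_coxeter_matrix m;
  coxeter_system_rel : coxeter_relations m gen;
  coxeter_system_gen : parabolic [set: S] = setT;
  coxeter_system_ext : forall (G : groupType) (f : S -> G),
    coxeter_relations m f ->
    exists2 phi : W -> G, {morph phi : x y / x * y} &
      forall s, phi (gen s) = f s }.

Definition expressible (w : W) (n : nat) : bool :=
  [exists u : n.-tuple S, \prod_(s <- u) gen s == w].

(* The word length with respect to S. Inverses of generators need not be
   allowed as letters since generators of a Coxeter system are involutions.
   The value 0 for inexpressible w is never used when S generates W. *)
Definition word_length (w : W) : nat :=
  if pselect (exists n, expressible w n) is left ex then ex_minn ex else 0%N.

(* \sum_(w in A) t^(word_length w). As S is finite, [fset_set] is applied to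
   finite sets only when S generates W. *)
Definition growth_series (A : set W) : fps int :=
  fun n => Posz #|` fset_set [set w | A w /\ word_length w = n] |%fset.

Definition spherical (T : {set S}) : bool := `[< finite_set (parabolic T) >].

Definition chi (T : {set S}) : int :=
  (\sum_(U : {set S} | spherical U && (T \subset U)) (-1) ^+ #|U|)%R.

Lemma gen_mul_self m s (WS : is_coxeter_system m) : gen s * gen s = 1.
Proof.
by have := coxeter_system_rel WS (coxeter_matrix_diag (coxeter_system_matrix WS) s); rewrite expg1.
Qed.

Lemma expressibleT m w (WS : is_coxeter_system m) : exists n, expressible w n.
Proof.
suff [u <-] : exists u : seq S, \prod_(s <- u) gen s = w.
  by exists (size u); apply/existsP; exists (in_tuple u).
have : (@classical_sets.setT W) w by [].
rewrite -(coxeter_system_gen WS)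
  => /(_ [set w | exists u : seq S, \prod_(s <- u) gen s = w]%classic).
apply; split; last by move=> _ [s _ <-]; exists [:: s]; rewrite big_seq1.
split; first by exists [::]; rewrite big_nil.
move=> _ _ [u <-] [v <-]; exists (u ++ rev v); rewrite big_cat; congr (_ * _).
elim: v => [|s v IH]; first by rewrite big_nil invg1.
rewrite rev_cons -cats1 big_cat big_seq1 IH big_cons invgM; congr (_ * _).
by apply: (mulgI (gen s)); rewrite (gen_mul_self s WS) mulgV.
Qed.

Lemma word_length_eq0 m w (WS : is_coxeter_system m) :
  (word_length w = 0%N) <-> w = 1.
Proof.
rewrite /word_length; case: pselect => [ex|/(_ (expressibleT w WS))//].
case: ex_minnP => n /existsP [u /eqP uw] nmin; split=> [n0|w1].
  by rewrite -uw; move: u {uw}; rewrite n0 => u; rewrite (tuple0 u) big_nil.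
apply/eqP; rewrite -leqn0; apply: nmin; apply/existsP; exists [tuple].
by rewrite w1 big_nil.
Qed.

Lemma growth_series0 m (A : set W) (WS : is_coxeter_system m) :
  A 1 -> growth_series A 0%N = 1%R.
Proof.
move=> A1; rewrite /growth_series.
suff -> : [set w | A w /\ word_length w = 0%N]%classic = [set 1]%classic.
  by rewrite fset_set1 cardfs1.
by apply/seteqP; split=> [w [_ /(word_length_eq0 _ WS)]|_ ->] //; split=> //;
  exact/(word_length_eq0 _ WS).
Qed.

(* In particular the inverse of a growth series is a genuine one. *)
Lemma growth_series_unit m (A : set W) (WS : is_coxeter_system m) :
  A 1 -> growth_series A \is a GRing.unit.
Proof. by move=> A1; rewrite fps_unitE (growth_series0 WS) // unitr1. Qed.

End Coxeter.

(* Main.v *)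
(* Every w in W factors uniquely as w = x v with x in W_T and v of minimal length
   in W_T v, and the lengths add up; these v are the elements whose left descent
   set D(v) is disjoint from T. Hence W(t) / W_T(t) is the growth series of
   {v | D(v) disjoint from T}. Multiplying the identity by W(t) and collecting
   the terms of a fixed w, the coefficient of t^(l(w)) is the sum of
   (-1)^(|T| + |U|) over T <= U, U spherical, T disjoint from D(w). Summing first
   over T <= U \ D(w) leaves the sum of (-1)^|U| over spherical U <= D(w). As W_U
   is finite whenever U <= D(w), this vanishes unless D(w) is empty, i.e. w = 1. *)
Require Import Defs.
From HB Require Import structures.
From mathcomp Require Import all_boot all_order all_algebra finmap.
From mathcomp Require Import boolp classical_sets functions cardinality.

Set Implicit Arguments.
Unset Strict Implicit.
Unset Printing Implicit Defensive.

Import GRing.Theory.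

(** * The reflection cocycle *)

Section ReflectionCocycle.
Local Open Scope group_scope.
Variable W : groupType.

(* The semidirect product of W with the group of sets of elements of W under
   symmetric difference, on which W acts by conjugation. *)
Definition set_ext : Type := (W * (W -> bool))%type.
HB.instance Definition _ := Choice.on set_ext.

Definition set_ext_mul (a b : set_ext) : set_ext :=
  (a.1 * b.1, fun x => a.2 x (+) b.2 (x ^ a.1)).
Definition set_ext_inv (a : set_ext) : set_ext :=
  (a.1^-1, fun x => a.2 (x ^ a.1^-1)).
Definition set_ext_one : set_ext := (1, fun=> false).

Let set_ext_mulA : associative set_ext_mul.
Proof.
move=> a b c; congr pair => /=; first exact: mulgA.
by apply/funext => x; rewrite conjgM addbA.
Qed.

Let set_ext_mul1 : left_id set_ext_one set_ext_mul.
Proof.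
move=> [a A]; congr pair => /=; first exact: mul1g.
by apply/funext => x; rewrite conjg1.
Qed.

Let set_ext_mulr1 : right_id set_ext_one set_ext_mul.
Proof.
move=> [a A]; congr pair => /=; first exact: mulg1.
by apply/funext => x; rewrite addbF.
Qed.

Let set_ext_mulVg : left_inverse set_ext_one set_ext_inv set_ext_mul.
Proof.
move=> a; congr pair => /=; first exact: mulVg.
by apply/funext => x; rewrite addbb.
Qed.

Let set_ext_mulgV : right_inverse set_ext_one set_ext_inv set_ext_mul.
Proof.
move=> a; congr pair => /=; first exact: mulgV.
by apply/funext => x; rewrite conjgK addbb.
Qed.

HB.instance Definition _ := isGroup.Build set_ext
  set_ext_mulA set_ext_mul1 set_ext_mulr1 set_ext_mulVg set_ext_mulgV.

(** Lift of [gen s] whose set part is a single reflection; the homomorphism extending these lifts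
    has the cocycle as set part. *)
Definition refl_ext (S : Type) (gen : S -> W) (s : S) : set_ext :=
  (gen s, fun x => x == gen s).

Variables (S : finType) (gen : S -> W) (m : S -> S -> option nat).
Hypothesis WS : is_coxeter_system gen m.

Lemma gen_inv s : (gen s)^-1 = gen s.
Proof. by apply: (mulgI (gen s)); rewrite mulgV (gen_mul_self s WS). Qed.

Lemma gen_mulK s w : gen s * (gen s * w) = w.
Proof. by rewrite mulgA (gen_mul_self s WS) mul1g. Qed.

(** Each of the 2n factors adds its own reflection conjugated by the prefix before it; in order
    these are the c^i s. *)
Lemma refl_ext_expE s t n (c := gen s * gen t) :
  ((refl_ext gen s * refl_ext gen t) ^+ n : set_ext) =
  (c ^+ n, fun x => \big[addb/false]_(i < n.*2) (x == c ^+ i * gen s)).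
Proof.
(* Conjugation by [gen s] inverts [c]. *)
have sc k : gen s * c ^- k = c ^+ k * gen s.
  elim: k => [|k IH]; first by rewrite expg0 invg1 mulg1 mul1g.
  rewrite [in LHS]expgSr invgM mulgA.
  have -> : gen s * c^-1 = c * gen s by rewrite invgM !gen_inv mulgA.
  by rewrite -mulgA IH mulgA -expgS.
elim: n => [|n IH].
  by congr pair; apply/funext => x; rewrite big_ord0.
rewrite expgSr IH; congr pair; first by rewrite expgSr.
apply/funext => x /=; rewrite !big_ord_recr /= -addbA; congr (_ (+) (_ (+) _)).
  rewrite -(inj_eq (conjg_inj (c ^- n))) conjgK; congr (x == _).
  by rewrite conjgE invgK sc mulgA -expgnDr addnn.
rewrite -conjgM -(inj_eq (conjg_inj (c ^+ n * gen s)^-1)) conjgK; congr (x == _).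
rewrite conjgE invgK invgM gen_inv -!mulgA.
have -> : gen t * (gen s * c ^- n) = gen t * (c ^+ n * gen s) by rewrite sc.
have -> : gen s * (gen t * (c ^+ n * gen s)) = c * (c ^+ n * gen s) by rewrite !mulgA.
by rewrite (mulgA (c ^+ n)) -expgSr mulgA -expgnDr addSn addnn.
Qed.

(** If c^k = 1 then c^(k+i) s = c^i s, so the 2k reflections cancel in pairs. *)
Lemma refl_ext_relations : coxeter_relations m (refl_ext gen).
Proof.
move=> s t k mst; rewrite refl_ext_expE (coxeter_system_rel WS mst).
congr pair; apply/funext => x; rewrite -addnn big_split_ord /=.
rewrite -big_split /= big1 // => i _.
by rewrite expgnDr (coxeter_system_rel WS mst) mul1g addbb.
Qed.

(* [N w] is the set of reflections that separate 1 from w. *)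
Lemma reflection_cocycle : exists N : W -> W -> bool,
  (forall x, N 1 x = false) /\
  (forall s w x, N (gen s * w) x = (x == gen s) (+) N w (x ^ gen s)).
Proof.
have [phi phiM phig] := coxeter_system_ext WS refl_ext_relations.
have phi1 : phi 1 = 1.
  by apply: (mulgI (phi 1)); rewrite -phiM !mulg1.
exists (fun w => (phi w).2); split; first by rewrite phi1.
by move=> s w x; rewrite phiM phig.
Qed.

End ReflectionCocycle.

(** * Word length and the exchange condition *)

Section Length.
Local Open Scope group_scope.
Variables (W : groupType) (S : finType) (gen : S -> W).
Variable m : S -> S -> option nat.
Hypothesis WS : is_coxeter_system gen m.

Implicit Types (s t : S) (u v : seq S) (w x y : W) (T U : {set S}).

Local Notation "''l' w" := (word_length gen w) (at level 8, w at level 2).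
Local Notation ev u := (\prod_(s <- u) gen s).

Lemma word_length_le u : 'l (ev u) <= size u.
Proof.
rewrite /word_length; case: pselect => // ex.
case: ex_minnP => n _; apply; apply/existsP.
by exists (in_tuple u); rewrite /=.
Qed.

Lemma reduced_word w : exists2 u, ev u = w & size u = 'l w.
Proof.
rewrite /word_length; case: pselect => [ex|/(_ (expressibleT w WS))//].
case: ex_minnP => n /existsP[u /eqP uw] _.
by exists u; rewrite ?size_tuple.
Qed.

Lemma word_length_genM s w : 'l (gen s * w) <= ('l w).+1.
Proof.
have [u <- <-] := reduced_word w.
by have := word_length_le (s :: u); rewrite big_cons.
Qed.

Lemma word_length_genMV s w : 'l w <= ('l (gen s * w)).+1.
Proof. by rewrite -{1}(gen_mulK WS s w) word_length_genM. Qed.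

(* The exchange condition, for words that need not be reduced. *)
Lemma exchange s u : 'l (gen s * ev u) <= 'l (ev u) ->
  exists u1 t u2, u = u1 ++ t :: u2 /\ gen s * ev u = ev (u1 ++ u2).
Proof.
have [N [N1 NM]] := reflection_cocycle WS.
(* A reflection in [N (ev v)] is a letter of v conjugated by the prefix before it; multiplying by it
   deletes that letter. *)
have del x v : N (ev v) x ->
    exists u1 t u2, v = u1 ++ t :: u2 /\ x * ev v = ev (u1 ++ u2).
  elim: v x => [|r v IH] x; first by rewrite big_nil N1.
  rewrite big_cons NM; have [->|_] := eqVneq x (gen r).
    by move=> _; exists [::], r, v; rewrite (gen_mulK WS).
  move=> /IH [u1 [t [u2 [-> e]]]]; exists (r :: u1), t, u2; split=> //.
  by rewrite cat_cons big_cons -e conjgE !mulgA mulgV mul1g.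
(* Otherwise [gen s] lies in [N (gen s * ev u)], and deleting a letter from a reduced word of that
   element makes [ev u] shorter than it. *)
move=> lsu; apply: (del); apply/negPn/negP => Nu.
have : N (gen s * ev u) (gen s) by rewrite NM eqxx conjgE mulKg (negbTE Nu).
have [v vE vs] := reduced_word (gen s * ev u).
rewrite -vE => /del [v1 [t [v2 [ve]]]].
rewrite vE (gen_mulK WS) => uE; move: lsu; rewrite uE -uE -vs ve size_cat /= addnS.
by rewrite uE ltnNge -size_cat word_length_le.
Qed.

(** * Parabolic subgroups and their reduced words *)

Lemma parabolic1 T : parabolic gen T 1.
Proof. by move=> H [[]]. Qed.

Lemma parabolic_divg T x y :
  parabolic gen T x -> parabolic gen T y -> parabolic gen T (x * y^-1).
Proof. by move=> Tx Ty H HT; apply: HT.1.2; [exact: Tx|exact: Ty]. Qed.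

Lemma parabolicV T x : parabolic gen T x -> parabolic gen T x^-1.
Proof. by move=> Tx; rewrite -(mul1g x^-1); apply: parabolic_divg => //; exact: parabolic1. Qed.

Lemma parabolicM T x y :
  parabolic gen T x -> parabolic gen T y -> parabolic gen T (x * y).
Proof. by move=> Tx /parabolicV Ty; rewrite -(invgK y); apply: parabolic_divg. Qed.

Lemma parabolic_gen T s : s \in T -> parabolic gen T (gen s).
Proof. by move=> sT H [_]; apply; exists s. Qed.

Lemma parabolic_word T u : all [in T] u -> parabolic gen T (ev u).
Proof.
elim: u => [|s u IH] /=; first by move=> _; rewrite big_nil; exact: parabolic1.
by case/andP=> /parabolic_gen sT /IH uT; rewrite big_cons; exact: parabolicM.
Qed.

Lemma parabolic_subset T U : T \subset U -> (parabolic gen T `<=` parabolic gen U)%classic.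
Proof.
move=> /fintype.subsetP TU; apply: smallest_sub.
  by split; [exact: parabolic1|exact: parabolic_divg].
by move=> _ [s /TU sU <-]; exact: parabolic_gen.
Qed.

Lemma parabolic_has_word T w : parabolic gen T w -> exists2 u, all [in T] u & ev u = w.
Proof.
apply: (smallest_sub (X := [set w | exists2 u, all [in T] u & ev u = w]%classic));
  last by move=> _ [s sT <-]; exists [:: s]; rewrite ?big_seq1 //= andbT.
split; first by exists [::]; rewrite ?big_nil.
move=> _ _ [u uT <-] [v vT <-]; exists (u ++ rev v); first by rewrite all_cat uT all_rev.
rewrite big_cat; congr (_ * _).
elim: v {vT} => [|s v IH]; first by rewrite big_nil invg1.
by rewrite rev_cons -cats1 big_cat big_seq1 IH big_cons invgM (gen_inv WS).
Qed.

(** If prepending s to a reduced word in T does not lengthen it, exchange deletes a letter, and the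
    remaining letters are still in T. *)
Lemma parabolic_reduced_word T w : parabolic gen T w ->
  exists u, [/\ all [in T] u, ev u = w & size u = 'l w].
Proof.
case/parabolic_has_word => u + <-; elim: u => [|s u IH] /=.
  move=> _; exists [::]; rewrite big_nil; split=> //.
  by apply/esym/(word_length_eq0 _ WS).
case/andP=> sT /IH[v [vT vE vs]]; rewrite big_cons -vE.
have [lt|le] := ltnP ('l (ev v)) ('l (gen s * ev v)).
  exists (s :: v); rewrite /= sT vT big_cons; split=> //.
  by apply/eqP; rewrite eqn_leq vs -vE lt word_length_genM.
have [v1 [t [v2 [e es]]]] := exchange le.
have := word_length_genMV s (ev v); rewrite es vE -vs e size_cat /= addnS ltnS -size_cat => ls.
move: vT; rewrite e all_cat /= => /and3P[v1T _ v2T].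
exists (v1 ++ v2); rewrite all_cat v1T v2T; split=> //.
by apply/eqP; rewrite eqn_leq word_length_le ls.
Qed.


(* A letter of u cannot be the deleted one, as s :: u is reduced. *)
Lemma exchange_cat s u v : size (s :: u) = 'l (ev (s :: u)) ->
  'l (gen s * ev (u ++ v)) <= 'l (ev (u ++ v)) ->
  exists2 v', size v = (size v').+1 & gen s * ev (u ++ v) = ev (u ++ v').
Proof.
move=> lsu /exchange [u1 [t [u2 [e es]]]].
have e1 : u1 = take (size u1) (u ++ v) by rewrite e take_size_cat.
have e2 : t :: u2 = drop (size u1) (u ++ v) by rewrite e drop_size_cat.
move: e1 e2; rewrite take_cat drop_cat; case: ltnP => [lt|le] e1 e2; last first.
  exists (take (size u1 - size u) v ++ u2).
    by rewrite -{1}(cat_take_drop (size u1 - size u) v) -e2 !size_cat addnS.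
  by rewrite es catA -e1.
case: (drop (size u1) u) (cat_take_drop (size u1) u) e2 => [|r u3] e3.
  by move: lt; rewrite -e3 cats0 -e1 ltnn.
(* After a deletion inside u, v cancels and [s :: u] equals a word shorter than u. *)
move=> [_ u2E]; have : ev (s :: u) = ev (u1 ++ u3).
  by rewrite big_cons; move: es; rewrite u2E catA [in LHS]big_cat [in RHS]big_cat /= mulgA => /mulIg.
move=> lsu'; move: lsu; rewrite lsu' => /eqP.
rewrite gtn_eqF // (leq_ltn_trans (word_length_le _)) //=.
by rewrite -e3 -e1 !size_cat /= addnS ltnS leqW.
Qed.

Lemma reduced_behead s u : size (s :: u) = 'l (ev (s :: u)) -> size u = 'l (ev u).
Proof.
move=> /= lsu; apply/eqP; rewrite eqn_leq word_length_le andbT -ltnS lsu big_cons.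
exact: word_length_genM.
Qed.

(** * Left descents *)

Definition left_descent w : {set S} := [set s | 'l (gen s * w) < 'l w]%SET.

Lemma left_descent_eq0 w : (left_descent w == finset.set0) = (w == 1).
Proof.
apply/eqP/eqP => [D0|->]; last first.
  by apply/setP => s; rewrite !inE ((word_length_eq0 1 WS).2 erefl) ltn0.
have [[|s u] uw us] := reduced_word w; first by rewrite -uw big_nil.
have : s \in left_descent w.
  by rewrite inE -us -uw big_cons (gen_mulK WS) ltnS word_length_le.
by rewrite D0 inE.
Qed.

(** Induction on u: for a descent s of x, exchange in a reduced word [u ++ v] of x can only delete
    from v, so s may be moved to the front. *)
Lemma left_descent_prefix T x u : T \subset left_descent x -> all [in T] u ->
  size u = 'l (ev u) -> exists2 v, ev (u ++ v) = x & size (u ++ v) = 'l x.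
Proof.
move=> /fintype.subsetP Tx; elim: u => [|s u IH] /=.
  by move=> _ _; have [v] := reduced_word x; exists v.
case/andP => sT uT lsu.
have [v vx vl] := IH uT (reduced_behead lsu).
have := Tx s sT; rewrite inE -vx => /ltnW /(exchange_cat lsu) [v' vv' e].
exists v'; first by rewrite big_cons -e (gen_mulK WS).
by rewrite vx -vl !size_cat vv' addnS.
Qed.

(** * Minimal coset representatives *)

Definition coset_min T : set W :=
  [set v : W | forall x, parabolic gen T x -> 'l v <= 'l (x * v)]%classic.

(** Prepend the letters of a reduced word of x one by one: a failure to lengthen would delete a
    letter of v and yield a shorter element of its coset. *)
Lemma word_length_coset_min T x (v : W) :
  parabolic gen T x -> coset_min T v -> 'l (x * v) = 'l x + 'l v.
Proof.
case/parabolic_reduced_word=> u [uT <- lu] vmin; rewrite -lu.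
have [v' vE lv] := reduced_word v; rewrite -vE.
elim: u uT lu => [|s u IH] /=; first by rewrite big_nil mul1g.
case/andP=> sT uT lsu.
have {}IH : 'l (ev u * ev v') = size u + 'l (ev v').
  by apply: IH => //; exact: (@reduced_behead s).
rewrite big_cons -mulgA; apply/eqP; rewrite eqn_leq -{1}addn1 addnAC -IH addn1.
rewrite word_length_genM /= addSn -IH ltnNge; apply/negP.
rewrite -big_cat => /(exchange_cat lsu) [v2 lv2].
rewrite !big_cat /= => e; suff: 'l v <= size v2 by rewrite -lv lv2 ltnn.
(* This element of W_T carries v to [ev v2], which has one letter less. *)
have Ty : parabolic gen T ((ev u)^-1 * (gen s * ev u)).
  apply: parabolicM; first by apply: parabolicV; exact: parabolic_word.
  by apply: parabolicM; [exact: parabolic_gen|exact: parabolic_word].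
apply: leq_trans (vmin _ Ty) _; rewrite -vE -!mulgA e mulKg.
exact: word_length_le.
Qed.

Lemma exists_coset_min T w :
  exists x (v : W), [/\ parabolic gen T x, coset_min T v & w = x * v].
Proof.
have ex : exists n, `[< exists2 x, parabolic gen T x & 'l (x * w) = n >].
  exists ('l (1 * w)); apply/asboolP; exists 1 => //; exact: parabolic1.
case: (ex_minnP ex) => n /asboolP[x Tx xn] nmin.
exists x^-1, (x * w); split; [exact: parabolicV| |by rewrite mulKg].
move=> y Ty; rewrite xn; apply: nmin; apply/asboolP.
by exists (y * x); [exact: parabolicM|rewrite mulgA].
Qed.

(** For the converse, write v = x v0 with v0 minimal. Lengths add, so the first letter of a nonempty
    reduced word of x would be a descent of v in T. *)
Lemma coset_minE T (v : W) : coset_min T v <-> [disjoint T & left_descent v].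
Proof.
split=> [vmin|dis].
  apply/pred0P => s /=; apply/negP => /andP[sT].
  by rewrite inE ltnNge vmin //; exact: parabolic_gen.
have [x [v0 [Tx v0min vE]]] := exists_coset_min T v.
have [u [uT ux lu]] := parabolic_reduced_word Tx.
case: u uT ux lu => [_|s u /= /andP[sT uT]].
  by rewrite big_nil vE => <-; rewrite mul1g.
move=> ux lu; have : s \in left_descent v.
  rewrite inE vE (word_length_coset_min Tx) // -lu -ux big_cons -mulgA (gen_mulK WS).
  rewrite (@word_length_coset_min T) //=; last exact: parabolic_word.
  by rewrite addSn ltnS leq_add2r word_length_le.
by move/pred0P: dis => /(_ s) /=; rewrite sT => /= ->.
Qed.

(** With y = x'^-1 x, the length of v' = y v is l(y) + l(v), yet at most l(v) by minimality of v';
    so y = 1. *)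
Lemma coset_min_inj T x x' (v v' : W) : parabolic gen T x -> parabolic gen T x' ->
  coset_min T v -> coset_min T v' -> x * v = x' * v' -> x = x' /\ v = v'.
Proof.
move=> Tx Tx' vm vm' e.
have Ty : parabolic gen T (x'^-1 * x) by apply: parabolicM => //; exact: parabolicV.
have v'E : v' = (x'^-1 * x) * v by rewrite -mulgA e mulKg.
have : 'l (x'^-1 * x) = 0%N.
  apply/eqP; have := vm' _ (parabolicV Ty).
  rewrite {2}v'E mulKg v'E (word_length_coset_min Ty) //.
  by rewrite -{2}(add0n ('l v)) leq_add2r leqn0.
move/(word_length_eq0 _ WS) => y1; rewrite v'E y1 mul1g; split=> //.
by rewrite -(mulVKg x' x) y1 mulg1.
Qed.

(** * Finiteness of parabolic subgroups *)

Lemma finite_word_length n : finite_set [set w | 'l w = n]%classic.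
Proof.
apply: (sub_finite_set (B := [set ev (val u) | u in [set: n.-tuple S]]%classic)).
  move=> w <-; have [u uw lu] := reduced_word w; rewrite -lu.
  by exists (in_tuple u).
by apply: finite_image; exact: finite_finset.
Qed.

(** Each element of W_T is given by a prefix of a reduced word of w, so its length is at most
    l(w). *)
Lemma spherical_left_descent T w : T \subset left_descent w -> spherical gen T.
Proof.
move=> Tw; apply/asboolP.
apply: (sub_finite_set (B := (\bigcup_(n in `I_('l w).+1) [set x | 'l x = n])%classic)).
  move=> x /parabolic_reduced_word [u [uT <- lu]]; exists (size u) => //=.
  have [v _ <-] := left_descent_prefix Tw uT lu.
  by rewrite size_cat ltnS leq_addr.
by apply: bigcup_finite => [|n _]; [exact: finite_II|exact: finite_word_length].
Qed.

Lemma spherical_subset T U : T \subset U -> spherical gen U -> spherical gen T.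
Proof.
move=> /parabolic_subset TU /asboolP Ufin; apply/asboolP.
exact: sub_finite_set Ufin.
Qed.

End Length.

(** * Alternating sums over subsets *)

Lemma sum_sign_subset (S : finType) (A : {set S}) :
  (\sum_(T : {set S} | T \subset A) (-1) ^+ #|T| = (A == finset.set0)%:R :> int)%R.
Proof.
(* Expanding, T records where the first summand is chosen; a factor with i in A is 0. *)
transitivity (\prod_(i : S) ((if i \in A then -1 else 0) + 1) : int)%R.
  rewrite bigA_distr big_mkcond /=; apply: eq_bigr => T _.
  case: ifPn => [/fintype.subsetP TA|/subsetPn[s sT sA]]; last first.
    by rewrite (bigD1 s) //= sT (negbTE sA) mul0r.
  rewrite -big_mkcond /= (eq_bigr (fun=> -1)%R) ?prodr_const //.
  by move=> i /TA ->.
have [->|/set0Pn [s sA]] := eqVneq A finset.set0.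
  by rewrite big1 // => i _; rewrite inE add0r.
by rewrite (bigD1 s) //= sA addNr mul0r.
Qed.

(** * Growth series and the summation over spherical subsets *)

Section GrowthSeries.
Local Open Scope ring_scope.
Variables (W : groupType) (S : finType) (gen : S -> W).
Variable m : S -> S -> option nat.
Hypothesis WS : is_coxeter_system gen m.

Local Notation "''l' w" := (word_length gen w) (at level 8, w at level 2).

Definition sphere (A : set W) n : {fset W} :=
  fset_set [set w | A w /\ word_length gen w = n]%classic.

Lemma in_sphere A n w : (w \in sphere A n) = `[< A w /\ 'l w = n >].
Proof.
rewrite in_fset_set; last by apply: sub_finite_set (finite_word_length WS n) => x [].
by apply/idP/asboolP; rewrite inE.
Qed.

(** The index set no longer depends on A, so sums over T and over w can be exchanged. *)
Lemma growth_seriesE A n : growth_series gen A n =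
  \sum_(w <- sphere setT n) (`[< A w >] : nat)%:R.
Proof.
rewrite /growth_series -/(sphere A n).
have -> : sphere A n = [fset w in sphere setT n | `[< A w >]]%fset.
  apply/fsetP => w; rewrite !inE /= !in_sphere.
  by apply/asboolP/andP => [[? ?]|[/asboolP[_ ?] /asboolP]] //; split; exact/asboolP.
rewrite card_fset_sum1 big_fset /= -natz natr_sum big_mkcond /=.
by apply: eq_bigr => w _; case: ifP.
Qed.

(** Multiplication is a length-additive bijection from A x B to C; elements of length n are sorted
    by the length of their A-factor. *)
Lemma growth_series_mul (A B C : set W) :
  (forall x v, A x -> B v -> C (x * v)%g /\ 'l (x * v)%g = ('l x + 'l v)%N) ->
  (forall w, C w -> exists x v, [/\ A x, B v & w = (x * v)%g]) ->
  (forall x x' v v', A x -> A x' -> B v -> B v' -> (x * v = x' * v')%g ->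
    x = x' /\ v = v') ->
  growth_series gen C = growth_series gen A * growth_series gen B.
Proof.
move=> hmul hfact hinj; apply/funext => n; rewrite fps_mulE.
(* [p] chooses the A-factor; its value outside C is arbitrary. *)
have [p pP] : exists p : W -> W, forall w, C w ->
    exists v, [/\ A (p w), B v & w = (p w * v)%g].
  have ex w : exists x, C w -> exists v, [/\ A x, B v & w = (x * v)%g].
    have [/hfact[x [v h]]|nC] := pselect (C w); last by exists 1%g.
    by exists x => _; exists v.
  by exists (fun w => sval (cid (ex w))) => w; exact: svalP (cid (ex w)).
rewrite /growth_series -!/(sphere _ _).
transitivity (Posz (\sum_(i < n.+1) #|` sphere A i| * #|` sphere B (n - i)|)%N);
  last by rewrite -natz natr_sum; apply: eq_bigr => i _; rewrite natz PoszM.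
congr Posz; rewrite card_fset_sum1.
(* [inord] loses nothing, as the A-factor has length at most n. *)
rewrite (partition_big (fun w => inord ('l (p w)) : 'I_n.+1) xpredT) //=.
apply: eq_bigr => i _.
transitivity #|` [fset (x * v)%g | x in sphere A i, v in sphere B (n - i)]|%fset; last first.
  rewrite !card_fset_sum1 big_distrlr /= big_imfset2 //.
  move=> [x v] [x' v'] /=; rewrite !inE /= !in_sphere.
  move=> /andP[/asboolP[Ax _] /asboolP[Bv _]] /andP[/asboolP[Ax' _] /asboolP[Bv' _]] e.
  by have [-> ->] := hinj _ _ _ _ Ax Ax' Bv Bv' e.
rewrite big_fset_condE -card_fset_sum1.
congr #|` _|; apply/fsetP => w; rewrite !inE /= in_sphere.
apply/andP/imfset2P => /= [[/asboolP[Cw lw] /eqP pi]|[x + [v +]]].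
  have [v [Ap Bv wE]] := pP w Cw; have [_ lE] := hmul _ _ Ap Bv.
  have pi' : 'l (p w) = i.
    rewrite -pi inordK // ltnS -lw {2}wE lE; exact: leq_addr.
  exists (p w); first by rewrite in_sphere; exact/asboolP.
  exists v => //; rewrite in_sphere; apply/asboolP; split=> //.
  have nE : (i + 'l v)%N = n by rewrite -pi' -lE -wE.
  by rewrite -[X in (X - _)%N]nE addKn.
rewrite !in_sphere => /asboolP[Ax lx] /asboolP[Bv lv] ->.
have [Cxv lxv] := hmul _ _ Ax Bv.
have [v' [Ap Bv' e]] := pP _ Cxv.
have [<- _] := hinj _ _ _ _ Ax Ap Bv Bv' e.
split; last by rewrite lx inord_val.
by apply/asboolP; split=> //; rewrite lxv lx lv subnKC // -ltnS.
Qed.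

Lemma growth_series_parabolic_mul (T : {set S}) :
  growth_series gen (parabolic gen T) * growth_series gen (coset_min gen T)
  = growth_series gen setT.
Proof.
apply/esym/growth_series_mul.
- by move=> x v Tx vm; split=> //; exact: (word_length_coset_min WS Tx).
- by move=> w _; have [x [v h]] := exists_coset_min gen T w; exists x, v.
- by move=> x x' v v' Tx Tx' vm vm'; exact: (coset_min_inj WS Tx Tx').
Qed.

Lemma sum_left_descent_chi w :
  \sum_(T : {set S} | spherical gen T)
     (`[< coset_min gen T w >] : nat)%:R * ((-1) ^+ #|T| * chi gen T) =
  (w == 1%g)%:R :> int.
Proof.
pose D := left_descent gen w.
under eq_bigr => T _ do rewrite (asbool_equiv_eq (coset_minE WS T w)) asboolb mulrA big_distrr.
rewrite (exchange_big_dep (spherical gen)) /=; last by move=> T U _ /andP[].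
(* The right side becomes an alternating sum over U inside D(w), so the sides are compared one U at
   a time. *)
rewrite -(left_descent_eq0 WS) -sum_sign_subset big_mkcond [RHS]big_mkcond /=.
apply: eq_bigr => U _; case: ifPn => sU; last first.
  by case: ifP => // /(spherical_left_descent WS); rewrite (negbTE sU).
rewrite -big_distrl /=.
transitivity ((U \subset D)%:R * (-1) ^+ #|U| : int);
  last by case: ifP; rewrite ?mul1r ?mul0r.
congr (_ * _).
(* The indicator of U inside D is that of U \ D being empty, again an alternating sum, now over
   T. *)
rewrite -finset.setD_eq0 -sum_sign_subset big_mkcond [RHS]big_mkcond /=.
apply: eq_bigr => T _; rewrite finset.subsetD.
case TU: (T \subset U); rewrite ?andbF //= (spherical_subset TU sU) sU -/D.
by case: ifP; rewrite ?mul1r ?mul0r.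
Qed.

(** The identity multiplied by W(t). In degree n each w of length n contributes
    [sum_left_descent_chi], so only w = 1 survives. *)
Lemma sum_chi_coset_min :
  \sum_(T : {set S} | spherical gen T)
     ((-1) ^+ #|T| * chi gen T)%:~R * growth_series gen (coset_min gen T) = 1.
Proof.
apply/funext => n.
have coefD : {morph (fun a : fps int => a n) : a b / a + b} by [].
rewrite (big_morph _ coefD (erefl : (0 : fps int) n = 0)).
have coefMz (a : fps int) (c : int) : (c%:~R * a) n = a n * c.
  have coefMn k : (a *+ k) n = a n *+ k.
    by elim: k => // k IH; rewrite !mulrS -IH.
  rewrite mulrzl -mulrzz; case: c => k; first exact: coefMn.
  (* Here the integer is [Negz k], that is -(k+1). *)
  exact: (congr1 (fun x : int => - x) (coefMn k.+1)).
under eq_bigr => T _ do rewrite coefMz growth_seriesE big_distrl.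
rewrite exchange_big /=; under eq_bigr => w _ do rewrite sum_left_descent_chi.
rewrite fps_oneE; case: eqP => [->|n0]; last first.
  rewrite big1_seq // => w /=; rewrite in_sphere => /asboolP[_ lw].
  by case: eqP => // /(word_length_eq0 w WS) w0; case: n0; rewrite -lw w0.
suff -> : sphere setT 0 = [fset 1%g]%fset by rewrite big_seq_fset1 eqxx.
apply/fsetP => w; rewrite in_sphere inE; apply/asboolP/eqP.
  by case=> _ /(word_length_eq0 w WS).
by move=> /(word_length_eq0 w WS).
Qed.

End GrowthSeries.

Local Open Scope ring_scope.

Theorem mainTheorem3 (S : finType) (m : S -> S -> option nat)
    (W : groupType) (gen : S -> W) (WS : is_coxeter_system gen m) :
  \sum_(T : {set S} | spherical gen T)
     ((-1) ^+ #|T| * chi gen T)%:~R / growth_series gen (parabolic gen T)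
  = (growth_series gen [set: W]%classic)^-1.
Proof.
have unitT T : growth_series gen (parabolic gen T) \is a GRing.unit.
  by apply: (growth_series_unit WS); exact: parabolic1.
have unitW : growth_series gen setT \is a GRing.unit.
  exact: (growth_series_unit WS).
apply: (mulIr unitW); rewrite mulVr // -[RHS](sum_chi_coset_min WS) big_distrl /=.
apply: eq_bigr => T _.
by rewrite -(growth_series_parabolic_mul WS T) mulrA divrK ?unitT.
Qed.
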